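(* Let $N=\{1,2\}$ and let $M$ be a finite set of agents forming the other side of the market, with non-dynamic additive (not necessarily binary) valuations. Then the Two-Phase Round-Robin Algorithm (defined in the context) is EF1-over-time: it is guaranteed to produce a sequence $x^1,x^2,\dots$, each $x^t$ consisting of a single match, such that the cumulative matching $X^t$ is EF1 for every $t\ge 0$.
   Context: Setting. $N=\{1,2\}$ and $M$ are disjoint finite sets of agents (labels of agents in $M$ are unrelated to those of $N$); $|M|$ is not required to equal $|N|$. At each time step $t=1,2,\dots$ a single match $x^t=\{i,j\}$ with $i\in N$, $j\in M$ is chosen irrevocably. The cumulative matching $X^t$ assigns to each agent $i\in N\cup M$ the multiset $X_i^t$ of agents matched to $i$ at times $1,\dots,t$ (with multiplicity); $X_i^0=\emptyset$. Additive valuations. Each agent $i$ has a real value $v_i(j)$ for each agent $j$ on the opposite side, not changing over time, and $v_i(Y)=\sum_{j\in Y}v_i(j)$ for a multiset $Y$ (with multiplicity). Envy and EF1. Envy is considered only within the same side of the market. For $i,j$ on the same side, $i$ envies $j$ under $X$ if $v_i(X_i)<v_i(X_j)$. $X$ is EF1 if whenever $i$ envies $j$ there is $k\in X_j$ such that $v_i(X_i)\ge v_i(X_j\setminus\{k\})$ (one occurrence of $k$ is removed). Two-Phase Round-Robin Algorithm. Time is divided into consecutive stages of $2|M|$ time steps, repeated forever. Each stage has two phases. Phase 1: start with pool $P=M$ and an empty list $\sigma$; the agents of $N$ alternate, starting with agent $1$; on her turn agent $i$ is matched to an agent $j\in\arg\max_{k\in P}v_i(k)$, $j$ is removed from $P$,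 and $(i,j)$ is appended to $\sigma$; this continues until $P=\emptyset$. Phase 2: go through $\sigma$ in order, and match the agents of $M$ in that same order, one per time step, with the agents of $N$ alternating starting with agent $2$ (so each agent of $M$ is matched to the agent of $N$ she was not matched to in Phase 1).
   Formalization: All values v_i(j) are assumed nonnegative on both sides: with negative values the claim fails, e.g. M={a}, v_1(a)=-1 at t=1, where agent 1 envies agent 2, whose bundle is empty. Existence of a run is claimed for nonempty M. *)

(* Defs.v *)
From mathcomp Require Import all_boot all_order all_algebra.
From mathcomp Require Import finmap multiset.
Set Implicit Arguments.
Unset Strict Implicit.
Unset Printing Implicit Defensive.
Import Order.TTheory GRing.Theory Num.Theory.
Local Open Scope mset_scope.
Local Open Scope ring_scope.

(* The side N = {1, 2} is 'I_2, with agents 1 and 2 being the ordinals 0 and 1;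
   the side M is an arbitrary finType. *)
Definition agent1 : 'I_2 := ord0.
Definition agent2 : 'I_2 := ord_max.
Definition other (i : 'I_2) : 'I_2 := if i == agent1 then agent2 else agent1.

(* A sequence of single matches is x : nat -> 'I_2 * M, where x k is the match
   made at time step k + 1 (so X^t is built from x 0, ..., x (t - 1)). *)
Section Matching.
Variable M : finType.

Definition cumN (x : nat -> 'I_2 * M) (t : nat) (i : 'I_2) : {mset M} :=
  seq_mset [seq p.2 | p <- mkseq x t & p.1 == i].

Definition cumM (x : nat -> 'I_2 * M) (t : nat) (j : M) : {mset 'I_2} :=
  seq_mset [seq p.1 | p <- mkseq x t & p.2 == j].

End Matching.

(* Fairness within one side A of the market, B being the opposite side;
   X a is the multiset of partners of agent a. *)
Section Fairness.
Variables (R : realFieldType) (A B : finType).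

Definition value (w : B -> R) (Y : {mset B}) : R := \sum_(k <- Y) w k.

Definition envies (v : A -> B -> R) (X : A -> {mset B}) (i j : A) : Prop :=
  value (v i) (X i) < value (v i) (X j).

(* Y `\ k removes a single occurrence of k from the multiset Y. Only an element
   of the envied bundle may be removed, so an agent with a single partner of
   negative value would not be EF1 towards an agent with no partner: this notion
   is meant for nonnegative values. *)
Definition EF1_side (v : A -> B -> R) (X : A -> {mset B}) : Prop :=
  forall i j : A, envies v X i j ->
    exists2 k, k \in X j & value (v i) (X i) >= value (v i) (X j `\ k).

End Fairness.

Section Algorithm.
Variables (R : realFieldType) (M : finType).

Definition EF1 (vN : 'I_2 -> M -> R) (vM : M -> 'I_2 -> R)
    (x : nat -> 'I_2 * M) (t : nat) : Prop :=
  EF1_side vN (cumN x t) /\ EF1_side vM (cumM x t).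

Definition EF1_over_time (vN : 'I_2 -> M -> R) (vM : M -> 'I_2 -> R)
    (x : nat -> 'I_2 * M) : Prop :=
  forall t : nat, EF1 vN vM x t.

(* phase1 vN i P sigma: sigma is a possible list of matches when i is to pick
   next from the pool P. Ties in the argmax may be broken arbitrarily. *)
Inductive phase1 (vN : 'I_2 -> M -> R) :
    'I_2 -> {set M} -> seq ('I_2 * M) -> Prop :=
| phase1_stop i : phase1 vN i set0 [::]
| phase1_pick i (P : {set M}) j sigma of
    j \in P & (forall k, k \in P -> vN i k <= vN i j) &
    phase1 vN (other i) (P :\ j) sigma :
    phase1 vN i P ((i, j) :: sigma).

Fixpoint phase2 (i : 'I_2) (sigma : seq ('I_2 * M)) : seq ('I_2 * M) :=
  if sigma is (_, j) :: sigma' then (i, j) :: phase2 (other i) sigma'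
  else [::].

Definition stage (vN : 'I_2 -> M -> R) (s : seq ('I_2 * M)) : Prop :=
  exists2 sigma, phase1 vN agent1 setT sigma & s = sigma ++ phase2 agent2 sigma.

(* x is a possible output of the algorithm; different stages may break ties
   differently. *)
Definition two_phase_round_robin (vN : 'I_2 -> M -> R)
    (x : nat -> 'I_2 * M) : Prop :=
  forall s : nat,
    stage vN (mkseq (fun k => x (s * (2 * #|M|) + k)%N) (2 * #|M|)).

End Algorithm.

(* Main.v *)
(** Over a complete stage both agents of [N] receive exactly the set [M], and
    each agent of [M] receives exactly [{1, 2}], so complete stages cancel from
    every envy comparison and only the current, unfinished stage matters.

    For [N], a run of the greedy picking sequence is fair: the agent who moves
    first at a given point never envies, and the other one does not envy after
    deletion of the first pick.  A prefix of Phase 1 is such a run.  After [q]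
    steps of Phase 2 both agents own the first [q] objects of [sigma], and beyond
    these they own what they picked in the corresponding suffix of [sigma], which
    is again a greedy run.

    For [M], in the current stage every agent has no partner or one partner
    during Phase 1, and one or two distinct partners during Phase 2. *)
Require Import Defs.
From mathcomp Require Import all_boot all_order all_algebra.
From mathcomp Require Import finmap multiset.
Set Implicit Arguments.
Unset Strict Implicit.
Unset Printing Implicit Defensive.
Import Order.TTheory GRing.Theory Num.Theory.
Local Open Scope mset_scope.
Local Open Scope ring_scope.

(** * Fairness on lists of partners *)

Section Fair.
Variables (R : realFieldType) (A B : finType).
Implicit Types (v : A -> B -> R) (X Y : A -> seq B).

Lemma value_seq_mset (w : B -> R) s : value w (seq_mset s) = \sum_(k <- s) w k.
Proof. exact/perm_big/perm_eq_seq_mset. Qed.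

Lemma value_msetB1 (w : B -> R) (Y : {mset B}) k :
  k \in Y -> value w (Y `\ k) = value w Y - w k.
Proof.
move=> kY; rewrite -[in RHS](msetB1K kY) -[(Y `\ k) in RHS]seq_mset_id.
by rewrite -mset_cons value_seq_mset big_cons addrC addKr.
Qed.

(** List form of [EF1_side]: values add up along concatenation, and deleting one occurrence of [k]
    becomes subtracting its value. *)
Definition fair v X := forall a b,
  \sum_(k <- X b) v a k <= \sum_(k <- X a) v a k \/
  exists2 k, k \in X b & \sum_(l <- X b) v a l - v a k <= \sum_(l <- X a) v a l.

Lemma fair_EF1_side v X : fair v X -> EF1_side v (fun a => seq_mset (X a)).
Proof.
move=> fX a b; rewrite /envies !value_seq_mset ltNge => /negP nle.
case: (fX a b) => // -[k kX le_k].
have kX' : k \in seq_mset (X b) by rewrite (perm_mem (perm_eq_seq_mset _)).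
by exists k; rewrite // value_msetB1 // !value_seq_mset.
Qed.

(** The offset [c a] depends on the evaluating agent alone, so it cancels from every comparison; an
    object deleted from [Y b] can also be deleted from [X b]. *)
Lemma fair_shift v X Y (c : A -> R) :
    (forall a b, \sum_(k <- X b) v a k = c a + \sum_(k <- Y b) v a k) ->
    (forall b, {subset Y b <= X b}) -> fair v Y -> fair v X.
Proof.
move=> XE sYX fY a b; rewrite !XE lerD2l; case: (fY a b) => [|[k kY le_k]].
  by left.
by right; exists k; [exact: sYX | rewrite -addrA lerD2l].
Qed.

End Fair.

Lemma otherK : involutive other.
Proof. by move=> i; apply/eqP; case: i => [[|[|?]] ?]. Qed.

Lemma eq_other (i j : 'I_2) : (i == other j) = (i != j).
Proof. by case: i => [[|[|?]] ?]; case: j => [[|[|?]] ?]. Qed.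

Lemma sum_agents (V : nmodType) (f : 'I_2 -> V) i :
  f i + f (other i) = f agent1 + f agent2.
Proof.
rewrite /other; case: eqP => [-> //|]; rewrite addrC => /eqP ni; congr (_ + f _).
by apply/eqP; move: ni; case: i => [[|[|?]] ?].
Qed.

(** * Structure of a single stage *)

Section Stage.
Variables (R : realFieldType) (M : finType).
Implicit Types (s : seq ('I_2 * M)) (v : 'I_2 -> M -> R).

Definition partnersN s (i : 'I_2) := [seq p.2 | p <- s & p.1 == i].
Definition partnersM s (j : M) := [seq p.1 | p <- s & p.2 == j].
Definition flip (p : 'I_2 * M) := (other p.1, p.2).

Lemma partnersN_cat s1 s2 i :
  partnersN (s1 ++ s2) i = partnersN s1 i ++ partnersN s2 i.
Proof. by rewrite /partnersN filter_cat map_cat. Qed.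

Lemma partnersM_cat s1 s2 j :
  partnersM (s1 ++ s2) j = partnersM s1 j ++ partnersM s2 j.
Proof. by rewrite /partnersM filter_cat map_cat. Qed.

Lemma partnersM_flip s j : partnersM (map flip s) j = map other (partnersM s j).
Proof. by rewrite /partnersM filter_map -!map_comp. Qed.

(** Every match gives its object to one agent in [s] and to the other in the flipped copy, so the
    total does not depend on [i]. *)
Lemma sum_partnersN_flip s i (f : M -> R) :
  \sum_(k <- partnersN (s ++ map flip s) i) f k = \sum_(p <- s) f p.2.
Proof.
rewrite partnersN_cat big_cat /= /partnersN filter_map -map_comp !big_map.
rewrite !big_filter [RHS](bigID (fun p => p.1 == i)) /=; congr (_ + _).
by apply: eq_bigl => p /=; rewrite eq_sym eq_other eq_sym.
Qed.

Lemma size_partnersM s j :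
  uniq (map snd s) -> size (partnersM s j) = (j \in map snd s).
Proof.
by move=> us; rewrite size_map size_filter -count_uniq_mem // count_map.
Qed.

(* Closed under prefixes and suffixes, unlike [phase1], which runs until the
   pool is empty. *)
Fixpoint greedy v i s :=
  if s is (a, j) :: s' then
    [&& a == i, all (fun p => v i p.2 <= v i j) s' & greedy v (other i) s']
  else true.

Lemma greedy_take v i s n : greedy v i s -> greedy v i (take n s).
Proof.
elim: s i n => [|[a j] s IHs] i [|n] //= /and3P[-> le_j /IHs ->].
by rewrite andbT /=; apply/allP => p /mem_take /(allP le_j).
Qed.

Lemma greedy_drop v i s n :
  greedy v i s -> exists i', greedy v i' (drop n s).
Proof.
elim: s i n => [|[a j] s IHs] i [|n] //= gs; try by exists i.
by case/and3P: gs => _ _ /IHs.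
Qed.

(** Both phases alternate strictly but start with opposite agents, so they disagree at every
    position. *)
Lemma phase2_greedy v i s : greedy v i s -> phase2 (other i) s = map flip s.
Proof.
by elim: s i => [|[a j] s IHs] i //= /and3P[/eqP-> _ /IHs ->].
Qed.

Lemma phase1_greedy v i P s : phase1 v i P s ->
  [/\ greedy v i s, uniq (map snd s) & map snd s =i P].
Proof.
elim=> {i P s} [i|i P j s jP max_j _ [gs us sE]].
  by split=> // k; rewrite in_set0.
split=> /=.
- rewrite eqxx gs andbT; apply/allP => p ps; apply: max_j.
  by have := map_f snd ps; rewrite sE !inE => /andP[].
- by rewrite us andbT sE !inE eqxx.
- by move=> k; rewrite inE sE !inE; case: eqP => [->|].
Qed.

Lemma phase1_exists v i P : exists s, phase1 v i P s.
Proof.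
move: {2}_.+1 (ltnSn #|P|) => n; elim: n i P => // n IHn i P.
have [->|[j0 j0P]] := set_0Vmem P; first by exists [::]; constructor.
case: (arg_maxP (v i) j0P) => j; rewrite /= => jP max_j.
rewrite ltnS (cardsD1 j) [j \in P]jP => ltP.
by have [s] := IHn (other i) _ ltP; exists ((i, j) :: s); constructor.
Qed.

(** [c] stands for the value to [other i] of her previous pick, made when all of [s] was still
    available. Each pick exchanges the roles of the agents, its value to the picker becomes the next
    [c], and each inequality for the tail yields the other one for [s]. *)
Lemma greedy_le v i s (c : R) :
    0 <= c -> (forall p, p \in s -> v (other i) p.2 <= c) -> greedy v i s ->
    (forall i j, 0 <= v i j) ->
  \sum_(k <- partnersN s (other i)) v i k <= \sum_(k <- partnersN s i) v i k /\
  \sum_(k <- partnersN s i) v (other i) k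
    <= c + \sum_(k <- partnersN s (other i)) v (other i) k.
Proof.
move=> c0 le_c gs v0; elim: s i c c0 le_c gs => [|[a j] s IHs] i c c0 le_c /=.
  by rewrite !big_nil addr0.
case/and3P=> /eqP-> /allP le_j gs.
have [] := IHs (other i) (v i j) (v0 _ _) _ gs; first by rewrite otherK.
rewrite otherK /partnersN /= eqxx -[i == other i](inv_eq otherK) eq_sym.
rewrite eq_other eqxx /= !big_cons => H1 H2; split=> //.
by apply: lerD H1; apply: (le_c (a, j)); rewrite mem_head.
Qed.

Lemma greedy_fair v i s :
  (forall i j, 0 <= v i j) -> greedy v i s -> fair v (partnersN s).
Proof.
move=> v0 gs.
have first i' s' : greedy v i' s' ->
    \sum_(k <- partnersN s' (other i')) v i' k <=
    \sum_(k <- partnersN s' i') v i' k.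
  (* Only the first inequality is wanted, so any upper bound on the values serves as [c]. *)
  move=> gs'; have [] // := @greedy_le v i' s' (\sum_k v (other i') k) _ _ gs' v0.
    by rewrite sumr_ge0.
  by move=> p _; rewrite (bigD1 p.2) //= lerDl sumr_ge0.
move=> a b; have [->|] := eqVneq a b; first by left.
rewrite -eq_other => /eqP ->; have [->|nb] := eqVneq b (other i).
  by left; rewrite otherK; exact: first.
have{nb} ->: b = i by apply/eqP; rewrite eq_other negbK in nb.
(* Without the first pick [j], what remains is a greedy run opened by [other i], who does not envy
   in it. *)
case: s gs => [|[c j] s] /=; first by left; rewrite !big_nil.
case/and3P=> /eqP-> _ /first; rewrite otherK /partnersN /= eqxx.
rewrite [i == other i]eq_other eqxx /= => le_s; right.
by exists j; rewrite ?mem_head // big_cons addrC addKr.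
Qed.

(** * Fairness at every moment of a stage *)

Lemma stage_fairN v i s n :
    (forall i j, 0 <= v i j) -> greedy v i s ->
  fair v (partnersN (take n (s ++ map flip s))).
Proof.
move=> v0 gs; rewrite take_cat; case: ltnP => _.
  exact/greedy_fair/greedy_take/gs.
rewrite -map_take; move: (n - _)%N => q; have [i' gd] := greedy_drop q gs.
(* The worth to [a] of the objects that both agents hold after [q] steps of Phase 2. *)
pose c a := \sum_(p <- take q s) v a p.2.
apply: (fair_shift (c := c)) (greedy_fair v0 gd) => [a b|b k].
  rewrite /c -(sum_partnersN_flip _ b) !partnersN_cat.
  rewrite -[in partnersN s b](cat_take_drop q s) partnersN_cat !big_cat /=.
  by rewrite addrAC.
rewrite partnersN_cat -[in partnersN s b](cat_take_drop q s).
rewrite partnersN_cat !mem_cat.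
by move=> ->; rewrite orbT.
Qed.

Lemma stage_fairM (w : M -> 'I_2 -> R) s n :
    (forall j i, 0 <= w j i) -> uniq (map snd s) -> map snd s =i predT ->
  fair w (partnersM (take n (s ++ map flip s))).
Proof.
move=> w0 us sE.
have split1 q j : exists a, (partnersM s j = [:: a]) /\
    (partnersM (take q s) j = [::] \/ partnersM (take q s) j = [:: a]).
  have := size_partnersM j us; rewrite sE /=.
  rewrite -[in partnersM s j](cat_take_drop q s) partnersM_cat.
  case: (partnersM (take q s) j) => [|a [|? ?]] //=.
    by case: (partnersM _ j) => [|a [|? ?]] //= _; exists a; split=> //; left.
  by case: (partnersM _ j) => //= _; exists a; split=> //; right.
rewrite take_cat; case: ltnP => _ a b.
  (* Deleting the only partner of [b] leaves value zero. *)
  have [k [_ [->|->]]] := split1 n b; first by left; rewrite big_nil sumr_ge0.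
  right; exists k; rewrite ?mem_head // big_seq1 subrr.
  by rewrite sumr_ge0.
rewrite -map_take !partnersM_cat !partnersM_flip; move: (n - _)%N => q.
have [ka [-> Ha]] := split1 q a; have [kb [-> [->|->]]] := split1 q b.
  right; exists kb; rewrite ?mem_head // big_seq1 subrr.
  by rewrite sumr_ge0.
(* Here [b] has both partners. Deleting [other ka] leaves [ka], which [a] has from Phase 1. *)
have ka_le : w a ka <=
    \sum_(k <- [:: ka] ++ map other (partnersM (take q s) a)) w a k.
  by rewrite big_cons lerDl sumr_ge0.
right; exists (other ka).
  rewrite !inE (inj_eq (inv_inj otherK)) [other ka == kb]eq_sym eq_other.
  by rewrite [kb == ka]eq_sym orNb.
apply: le_trans ka_le; rewrite /= big_cons big_seq1.
by rewrite (sum_agents (w a)) -(sum_agents (w a) ka) addrK.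
Qed.

Lemma stageP v s : stage v s ->
  exists s1, [/\ s = s1 ++ map flip s1, greedy v agent1 s1,
                 uniq (map snd s1) & map snd s1 =i predT].
Proof.
case=> s1 /phase1_greedy[gs us sE] ->; exists s1; split=> //.
  by rewrite -(phase2_greedy gs).
by move=> k; rewrite sE !inE.
Qed.

Lemma stage_sumN v s i (f : M -> R) :
  stage v s -> \sum_(k <- partnersN s i) f k = \sum_k f k.
Proof.
case/stageP=> s1 [-> _ us sE]; rewrite sum_partnersN_flip -(big_map snd xpredT).
rewrite -[RHS]big_enum; apply: perm_big; apply: uniq_perm => //.
  exact: enum_uniq.
by move=> k; rewrite sE mem_enum.
Qed.

Lemma stage_sumM v s j (f : 'I_2 -> R) :
  stage v s -> \sum_(k <- partnersM s j) f k = f agent1 + f agent2.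
Proof.
case/stageP=> s1 [-> _ us sE]; rewrite partnersM_cat partnersM_flip.
have := size_partnersM j us; rewrite sE.
case: (partnersM s1 j) => [|a [|? ?]] //= _.
by rewrite big_cons big_seq1 sum_agents.
Qed.

End Stage.

(** * Splitting time into stages *)

Lemma mkseqD (T : Type) (x : nat -> T) m n :
  mkseq x (m + n) = mkseq x m ++ mkseq (fun k => x (m + k)%N) n.
Proof.
rewrite /mkseq iotaD map_cat add0n -[in iota m n](addn0 m) iotaDl.
by rewrite -map_comp.
Qed.

Lemma take_mkseq (T : Type) (x : nat -> T) m n :
  (m <= n)%N -> take m (mkseq x n) = mkseq x m.
Proof. by move=> lemn; rewrite /mkseq -map_take take_iota (minn_idPl lemn). Qed.

Lemma sum_blocks (T : Type) (V : nmodType) (F : seq T -> V) (c : V)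
    (x : nat -> T) L n :
    F [::] = 0 -> (forall s t, F (s ++ t) = F s + F t) ->
    (forall s, F (mkseq (fun k => x (s * L + k)%N) L) = c) ->
  F (mkseq x (n * L)) = c *+ n.
Proof.
move=> F0 FD FL; elim: n => [|n IHn]; first by rewrite mulr0n.
by rewrite mulSn addnC mkseqD FD IHn FL mulrSr.
Qed.

Lemma two_phase_exists (R : realFieldType) (M : finType) (v : 'I_2 -> M -> R) :
  (0 < #|M|)%N -> exists x : nat -> 'I_2 * M, two_phase_round_robin v x.
Proof.
case/card_gt0P=> j0 _; have [s ps] := phase1_exists v agent1 [set: M].
have [gs us sE] := phase1_greedy ps.
have size_s : size s = #|M|.
  rewrite -(size_map snd) -(card_uniqP us); apply: eq_card => k.
  by rewrite sE !inE.
pose st := s ++ phase2 agent2 s.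
have size_st : size st = (2 * #|M|)%N.
  by rewrite /st size_cat -[agent2]/(other agent1) (phase2_greedy gs) size_map
             size_s mul2n addnn.
(* One stage is repeated periodically; the index stays below [size st], so the default is never
   returned. *)
exists (fun k => nth (agent1, j0) st (k %% (2 * #|M|))) => n; exists s => //.
rewrite -/st -[RHS](mkseq_nth (agent1, j0)) size_st.
apply/eq_in_map => k; rewrite mem_iota => /andP[_ ltk].
by rewrite modnMDl modn_small.
Qed.

Lemma two_phase_EF1 (R : realFieldType) (M : finType)
    (vN : 'I_2 -> M -> R) (vM : M -> 'I_2 -> R) (x : nat -> 'I_2 * M) :
    (forall i j, 0 <= vN i j) -> (forall j i, 0 <= vM j i) ->
  two_phase_round_robin vN x -> EF1_over_time vN vM x.
Proof.
move=> vN0 vM0 rr t.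
(* The sequence [x] itself supplies an element of [M]. *)
have : (0 < 2 * #|M|)%N by rewrite muln_gt0; apply/card_gt0P; exists (x 0%N).2.
move: rr; rewrite /two_phase_round_robin; move: (2 * #|M|)%N => L rr L_gt0.
have := ltn_pmod t L_gt0; rewrite [in EF1 _ _ _ _](divn_eq t L).
move: (t %/ L)%N (t %% L)%N => n r lt_rL.
(* First [n] complete stages, then the first [r] steps of the current one. *)
have xE : mkseq x (n * L + r) = mkseq x (n * L) ++
    take r (mkseq (fun k => x (n * L + k)%N) L).
  by rewrite (take_mkseq _ (ltnW lt_rL)) mkseqD.
have [s [sE gs us s_all]] := stageP (rr n).
have cumN_fair : fair vN (partnersN (mkseq x (n * L + r))).
  rewrite xE; apply: fair_shift (stage_fairN r vN0 gs) => [a b|b k]; last first.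
    by rewrite partnersN_cat mem_cat sE => ->; rewrite orbT.
  rewrite -sE partnersN_cat big_cat /=; congr (_ + _).
  apply: (@sum_blocks _ _ (fun s => \sum_(k <- partnersN s b) vN a k)).
  - by rewrite big_nil.
  - by move=> s1 s2; rewrite partnersN_cat big_cat.
  - by move=> m; apply: stage_sumN (rr m).
have cumM_fair : fair vM (partnersM (mkseq x (n * L + r))).
  rewrite xE; apply: fair_shift (stage_fairM r vM0 us s_all) => [a b|b k].
    rewrite -sE partnersM_cat big_cat /=; congr (_ + _).
    apply: (@sum_blocks _ _ (fun s => \sum_(k <- partnersM s b) vM a k)).
    - by rewrite big_nil.
    - by move=> s1 s2; rewrite partnersM_cat big_cat.
    - by move=> m; apply: stage_sumM (rr m).
  by rewrite partnersM_cat mem_cat sE => ->; rewrite orbT.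
by split; apply: fair_EF1_side.
Qed.

Theorem theorem6p1 (R : realFieldType) (M : finType)
    (vN : 'I_2 -> M -> R) (vM : M -> 'I_2 -> R)
    (vN_ge0 : forall i j, 0 <= vN i j) (vM_ge0 : forall j i, 0 <= vM j i) :
  ((0 < #|M|)%N -> exists x : nat -> 'I_2 * M, two_phase_round_robin vN x) /\
  (forall x : nat -> 'I_2 * M,
     two_phase_round_robin vN x -> EF1_over_time vN vM x).
Proof.
by split=> [|x]; [exact: two_phase_exists | exact: two_phase_EF1].
Qed.
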